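(* Let $M=\{\mathcal A,\mathcal H,ds\}$ be a spectral geometry on a compact metric space $(X,|\cdot|)$ with support $B$, and assume that its relative bounding radius $\nu=\nu(B)$ is finite. Then for every $p>0$ $$(2\nu)^p\,\mathrm{Tr}_\omega(|ds|^p)\ge H^p(X)$$ (in the case $\nu=0$, $H^p(X)>0$ this means that $\mathrm{Tr}_\omega(|ds|^p)=\infty$).
   Context: $|xy|$ is the distance in $X$; $\Delta\subset X^2$ is the diagonal; $|b|=|yy'|$ for $b=(y,y')$. Spectral geometry (in the concrete form to which every axiomatically defined one is isomorphic): a triple $M=M(B,m)=\{\mathcal A,\mathcal H,ds\}$ where $B\subset X^2\setminus\Delta$ (the support) is symmetric under $(y,y')\mapsto(y',y)$ and $B_t=\{b\in B:|b|\ge t\}$ is finite for each $t>0$; $m:B\to\mathbb N$ is a symmetric function; $\mathcal H$ consists of square-summable sections $\xi$ on $B$, $\xi(y,y')\in\mathbb C^{m(y,y')}$; $\mathcal A$ is the algebra of Lipschitz functions on $X$ acting by $(\pi(a)\xi)(y,y')=a(y)\xi(y,y')$; $(ds\,\xi)(y,y')=|yy'|\xi(y',y)$. Relative bounding radius: $Y_t\subset X$ is the projection of $B_t$ to $X$, $\delta(t)=\inf\{\delta>0: X\subset\bigcup_{y\in Y_t}D_\delta(y)\}$ with $D_\delta(y)$ the closed ball of radius $\delta$, and $\nu(B)=\limsup_{t\to0}\delta(t)/t$. Dixmier trace: $\omega$ is a fixed generalized limit (dilation-invariant state on bounded sequences extending the ordinary limit). For a positive compact operator $T$ with eigenvalues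 $\mu_0\ge\mu_1\ge\dots$ (with multiplicity, padded by zeros if finitely many), $\sigma_N(T)=\sum_{n=0}^{N-1}\mu_n$; $\mathrm{Tr}_\omega(T)=\lim_\omega\sigma_N(T)/\log N$ if $\sigma_N(T)/\log N$ ($N\ge2$) is bounded, and $\mathrm{Tr}_\omega(T)=\infty$ otherwise. Hausdorff measure (unnormalized): $H^p(X)=\lim_{t\to0}H^p_t(X)$, $H_t^p(X)=\inf\sum(\mathrm{diam}\,F)^p$, the infimum over all (countable) covers of $X$ by nonempty closed subsets $F$ of diameter $\le t$. *)

(* Defs.v *)
From HB Require Import structures.
From mathcomp Require Import all_boot all_order all_algebra.
From mathcomp Require Import all_classical all_reals all_analysis.
From mathcomp Require Import ring lra.
From mathcomp Require Export complex.

Set Implicit Arguments.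
Unset Strict Implicit.
Unset Printing Implicit Defensive.

Import Order.TTheory GRing.Theory Num.Theory.
Import numFieldNormedType.Exports.

Local Open Scope classical_set_scope.
Local Open Scope ring_scope.
Local Open Scope complex_scope.

(* Squared modulus of a complex number, as an element of [R]. *)
Definition cabs2 (R : rcfType) (z : R[i]) : R :=
  complex.Re z ^+ 2 + complex.Im z ^+ 2.

(* Sum of an absolutely summable family (no meaning is intended otherwise). *)
Definition rsum (R : realType) (I : choiceType) (D : set I) (f : I -> R) : R :=
  fine (esum D (EFin \o f)^\+)%E - fine (esum D (EFin \o f)^\-)%E.

Definition csum (R : realType) (I : choiceType) (D : set I) (f : I -> R[i]) :
    R[i] :=
  Complex (rsum D (fun b => complex.Re (f b)))
          (rsum D (fun b => complex.Im (f b))).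

Section SpectralGeometry.
Context {R : realType} {X : metricType R}.
Implicit Types (b : X * X).

Definition len b : R := mdist b.1 b.2.

Definition flip b : X * X := (b.2, b.1).

(* The data [M(B, m)], which determine the triple consisting of the algebra
   [lipschitz_fun] acting by [rep], the Hilbert space [hilb] with scalar product
   [inner], and the operator [ds], all defined below.
   Multiplicities are positive: they are the dimensions of the nonzero fibres
   over the points of the support. *)
Record spectral_geometry := SpectralGeometry {
  supp : set (X * X);
  mult : X * X -> nat;
  supp_offdiag : forall b, supp b -> b.1 <> b.2;
  supp_flip : forall b, supp b -> supp (flip b);
  supp_finite : forall t : R, 0 < t ->
    finite_set [set b | supp b /\ t <= len b];
  mult_gt0 : forall b, supp b -> (0 < mult b)%N;
  mult_flip : forall b, supp b -> mult (flip b) = mult b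
}.

Context (M : spectral_geometry).

Definition fibre_norm2 (xi : X * X -> nat -> R[i]) b : R :=
  \sum_(i < mult M b) cabs2 (xi b i).

(* A vector of the fibre [C^(m b)] is encoded as a function [nat -> R[i]]
   vanishing at the indices [i >= m b], so that [xi b] and [xi (flip b)] live
   in the same type. *)
Definition square_summable : {pred X * X -> nat -> R[i]} := fun xi =>
  `[< (forall b i, ~ (supp M b /\ (i < mult M b)%N) -> xi b i = 0) /\
      (\esum_(b in supp M) (fibre_norm2 xi b)%:E < +oo)%E >].

Lemma cabs2_ge0 (z : R[i]) : 0 <= cabs2 z.
Proof. by rewrite addr_ge0 ?sqr_ge0. Qed.

Lemma cabs2M (z w : R[i]) : cabs2 (z * w) = cabs2 z * cabs2 w.
Proof. by case: z w => [a b] [c d]; rewrite /cabs2 /=; ring. Qed.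

Lemma cabs2D (z w : R[i]) : cabs2 (z + w) <= 2 * cabs2 z + 2 * cabs2 w.
Proof.
case: z w => [a b] [c d]; rewrite /cabs2 /=.
by have := sqr_ge0 (a - c); have := sqr_ge0 (b - d); nra.
Qed.

Lemma fibre_norm2_ge0 xi b : 0 <= fibre_norm2 xi b.
Proof. by apply: sumr_ge0 => i _; exact: cabs2_ge0. Qed.

Lemma esum_scale_le (I : choiceType) (D : set I) (k : R) (f : I -> R) :
  0 <= k -> (forall i, 0 <= f i) ->
  (\esum_(i in D) (k * f i)%:E <= k%:E * \esum_(i in D) (f i)%:E)%E.
Proof.
move=> k0 f0; apply: ub_ereal_sup => _ [A [fA AD] <-].
under eq_fsbigr do rewrite EFinM.
rewrite -ge0_mule_fsumr; last by move=> i; rewrite lee_fin.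
rewrite lee_wpmul2l ?lee_fin//; apply: ereal_sup_ubound.
by exists A.
Qed.

Lemma square_summable_mul (c : X * X -> R[i]) (k : R) xi :
  (forall b, supp M b -> cabs2 (c b) <= k) -> xi \in square_summable ->
  (fun b i => c b * xi b i) \in square_summable.
Proof.
move=> ck /asboolP[xi0 xifin]; apply/asboolP; split=> [b i bi|].
  by rewrite xi0// mulr0.
have xi2 : (\esum_(b in supp M) (`|k| * fibre_norm2 xi b)%:E < +oo)%E.
  apply: le_lt_trans (esum_scale_le _ _ _) _ => //; first exact: fibre_norm2_ge0.
  by rewrite lte_mul_pinfty// ?lee_fin.
apply: le_lt_trans xi2; apply: le_esum => b Bb; rewrite lee_fin.
rewrite mulr_sumr ler_sum// => i _; rewrite cabs2M ler_wpM2r ?cabs2_ge0//.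
exact: le_trans (ck _ Bb) (ler_norm _).
Qed.

Lemma flipK : involutive flip. Proof. by case. Qed.

Lemma square_summable_flip xi : xi \in square_summable ->
  (fun b => xi (flip b)) \in square_summable.
Proof.
move=> /asboolP[xi0 xifin]; apply/asboolP; split=> [b i bi|].
  apply: xi0 => -[/supp_flip]; rewrite flipK => Bb; rewrite mult_flip// => mi.
  exact: bi.
have flip_bij : set_bij (supp M) (supp M) flip.
  split.
  - by move=> b; exact: supp_flip.
  - by move=> b b' _ _; exact: (can_inj flipK).
  - by move=> b Bb; exists (flip b); [exact: supp_flip|exact: flipK].
rewrite (reindex_esum _ _ _ _ flip_bij) in xifin.
apply: le_lt_trans xifin; apply: le_esum => b Bb.
by rewrite /fibre_norm2 mult_flip.
Qed.

Lemma square_summable_submod : submod_closed square_summable.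
Proof.
split.
  apply/asboolP; split=> // ; rewrite esum1// => b _.
  by rewrite /fibre_norm2 big1// => i _; rewrite /cabs2 /= expr0n addr0.
move=> a u v us vs.
have /asboolP[u0 ufin] : (fun b i => a * u b i) \in square_summable.
  exact: (@square_summable_mul (fun=> a) (cabs2 a)).
move/asboolP : vs => [v0 vfin]; apply/asboolP; split=> [b i bi|].
  have -> : (a *: u + v) b i = a * u b i + v b i by [].
  by rewrite u0// v0// addr0.
have fin f : (\esum_(b in supp M) (fibre_norm2 f b)%:E < +oo ->
    \esum_(b in supp M) (2 * fibre_norm2 f b)%:E < +oo)%E.
  move=> ffin; apply: le_lt_trans (esum_scale_le _ _ _) _ => //.
    exact: fibre_norm2_ge0.
  by rewrite lte_mul_pinfty// lee_fin.
apply: le_lt_trans (lte_add_pinfty (fin _ ufin) (fin _ vfin)).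
rewrite -esumD; [|by move=> b _; rewrite lee_fin mulr_ge0// fibre_norm2_ge0..].
apply: le_esum => b _; rewrite -EFinD lee_fin /fibre_norm2 !mulr_sumr -big_split.
by apply: ler_sum => i _; exact: cabs2D.
Qed.

HB.instance Definition _ := GRing.isSubmodClosed.Build R[i]
  (X * X -> nat -> R[i]) square_summable square_summable_submod.

Record hilb := Hilb {
  section_of :> X * X -> nat -> R[i];
  _ : section_of \in square_summable
}.

HB.instance Definition _ := [isSub for section_of].
HB.instance Definition _ := [Choice of hilb by <:].
HB.instance Definition _ := [SubChoice_isSubLmodule of hilb by <:].

Definition inner (xi eta : hilb) : R[i] :=
  csum (supp M) (fun b => \sum_(i < mult M b) xi b i * (eta b i)^*).

Lemma len_bounded : exists k : R, forall b, supp M b -> cabs2 (len b)%:C <= k.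
Proof.
have /finite_seqP[s sE] := supp_finite M ltr01.
have s_ub : exists k : R, forall b, b \in s -> cabs2 (len b)%:C <= k.
  elim: s {sE} => [|b0 s [k kP]]; first by exists 0.
  exists (Num.max (cabs2 (len b0)%:C) k) => b; rewrite inE le_max.
  by case/orP => [/eqP ->|/kP ->]; rewrite ?lexx ?orbT.
have [k kP] := s_ub; exists (Num.max k 1) => b Bb; rewrite le_max.
have [b1|b1] := leP 1 (len b).
  have : [set b | supp M b /\ 1 <= len b] b by [].
  by rewrite sE => /kP ->.
apply/orP; right; rewrite /cabs2 /= expr0n addr0.
by rewrite expr_le1 ?mdist_ge0// ltW.
Qed.

Lemma ds_subproof (xi : hilb) :
  (fun b i => (len b)%:C * xi (flip b) i) \in square_summable.
Proof.
have [k kP] := len_bounded; apply: (square_summable_mul kP).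
by apply: square_summable_flip; exact: valP.
Qed.

Definition ds (xi : hilb) : hilb := Hilb (ds_subproof xi).

Record lipschitz_fun := LipschitzFun {
  lip_val :> X -> R[i];
  _ : exists k : R, forall x y, `|lip_val x - lip_val y| <= (k * mdist x y)%:C
}.

Lemma compact_mdist_bounded (cX : compact [set: X]) (x0 : X) :
  exists k : R, forall x, mdist x0 x <= k.
Proof.
have cf : {within [set: X], continuous (fun x => mdist x0 x : R^o)}.
  apply/continuous_subspaceT => x; apply/cvgrPdist_lt => e e0.
  apply: (filterS _ (nbhsx_ballx x e e0)) => y; rewrite ballEmdist /= => xy.
  apply: le_lt_trans xy; rewrite ler_norml; apply/andP; split.
    by rewrite lerNl opprB lerBlDl metric_triangle.
  by rewrite lerBlDl (metric_sym x) metric_triangle.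
have [k [kr kP]] := compact_bounded (continuous_compact cf cX).
exists (k + 1) => x; apply: le_trans (ler_norm _) _.
by apply: (kP (k + 1)); [rewrite ltrDl|exists x].
Qed.

Lemma lipschitz_bounded (cX : compact [set: X]) (a : lipschitz_fun) :
  exists k : R, forall x, cabs2 (a x) <= k.
Proof.
have [[x0 _]|noX] := pselect (exists x : X, True); last first.
  by exists 0 => x; case: noX; exists x.
case: a => a /= [l lP]; have [k kP] := compact_mdist_bounded cX x0.
exists (2 * (`|l| * k) ^+ 2 + 2 * cabs2 (a x0)) => x.
rewrite -[a x](subrK (a x0)); apply: le_trans (cabs2D _ _) _.
rewrite lerD2r ler_wpM2l//.
have cabs2E (z : R[i]) : `|z| ^+ 2 = (cabs2 z)%:C by rewrite add_Re2_Im2.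
have lk0 : 0 <= `|l| * k by rewrite mulr_ge0// (le_trans (mdist_ge0 x0 x0)).
have lk0C : 0 <= (`|l| * k)%:C by rewrite ler0c.
rewrite -lecR -cabs2E rmorphXn ler_pXn2r ?nnegrE ?normr_ge0//.
apply: le_trans (lP _ _) _; rewrite lecR metric_sym.
apply: le_trans (ler_wpM2r (mdist_ge0 _ _) (ler_norm l)) _.
by rewrite ler_wpM2l.
Qed.

Lemma rep_subproof (cX : compact [set: X]) (a : lipschitz_fun) (xi : hilb) :
  (fun b i => a b.1 * xi b i) \in square_summable.
Proof.
have [k kP] := lipschitz_bounded cX a.
by apply: (@square_summable_mul _ k) => [b _|]; [exact: kP|exact: valP].
Qed.

Definition rep (cX : compact [set: X]) (a : lipschitz_fun) (xi : hilb) : hilb :=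
  Hilb (rep_subproof cX a xi).

Definition proj_supp (t : R) : set X :=
  fst @` [set b | supp M b /\ t <= len b].

Definition bounding_radius (t : R) : \bar R :=
  ereal_inf [set d%:E | d in [set d : R | 0 < d /\
    [set: X] `<=` \bigcup_(y in proj_supp t) [set x | mdist y x <= d]]].

Definition rel_bounding_radius : \bar R :=
  limf_esup (fun t : R => bounding_radius t * (t^-1)%:E)%E 0^'+.

End SpectralGeometry.
Arguments spectral_geometry {R} X.
Arguments inner {R X} M.
Arguments ds {R X} M.
Arguments rep {R X} M.

Section Operators.
Context {R : realType} {V : lmodType R[i]} (ip : V -> V -> R[i]).
Implicit Types (T A : V -> V).

Definition bounded_operator T : Prop :=
  linear T /\ exists k : R, forall v, ip (T v) (T v) <= k%:C * ip v v.

(* In [R[i]], [0 <= z] means that [z] is real and nonnegative. *)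
Definition positive_operator A : Prop :=
  bounded_operator A /\ forall v, 0 <= ip (A v) v.

(* The positive square root of [T^* T]; the last condition reads
   [A A = T^* T]. *)
Definition is_abs_operator T A : Prop :=
  positive_operator A /\ forall v w, ip (A (A v)) w = ip (T v) (T w).

Definition abs_operator T : V -> V :=
  xget (fun=> 0) [set A | is_abs_operator T A].

(* [T] is [A^p] for a positive compact [A]: since the eigenvectors of [A] span
   a dense subspace, its functional calculus is determined by their images. *)
Definition is_power_operator A (p : R) T : Prop :=
  bounded_operator T /\
  forall (l : R) (v : V), 0 <= l -> A v = l%:C *: v -> T v = (l `^ p)%:C *: v.

Definition power_operator A (p : R) : V -> V :=
  xget (fun=> 0) [set T | is_power_operator A p T].

Definition eigenspace_of T (l : R) : set V := [set v | T v = l%:C *: v].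

Definition has_dim (E : set V) (d : nat) : Prop :=
  exists e : 'I_d -> V, (forall i, E (e i)) /\
    forall v, E v -> exists! c : 'rV[R[i]]_d, v = \sum_(i < d) c 0 i *: e i.

(* The nonincreasing sequence of eigenvalues of a positive compact operator:
   each positive eigenvalue is repeated according to its multiplicity, and the
   sequence is padded by zeros if there are finitely many of them. *)
Definition is_eigenvalue_seq T (mu : nat -> R) : Prop :=
  [/\ forall n, 0 <= mu n,
      forall n, mu n.+1 <= mu n &
      forall l : R, 0 < l -> exists d : nat,
        has_dim (eigenspace_of T l) d /\ ([set n | mu n = l] #= `I_d)%card].

Definition eigenvalue_seq T : nat -> R :=
  xget (fun=> 0) [set mu | is_eigenvalue_seq T mu].

Definition sigma T (N : nat) : R := \sum_(n < N) eigenvalue_seq T n.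

(* Sequences indexed by [N >= 1] are encoded as functions of [N.-1]. The term
   [N = 1] is 0 because [ln 1 = 0] and [0^-1 = 0]; a generalized limit does not
   depend on it. *)
Definition log_mean T : nat -> R^o := fun n => sigma T n.+1 / ln n.+1%:R.

Definition dixmier_trace (w : (nat -> R^o) -> R) T : \bar R :=
  if `[< bounded_fun (log_mean T) >] then (w (log_mean T))%:E else +oo%E.

End Operators.

(* Only the values of [w] on bounded sequences matter. In terms of sequences
   indexed by [N >= 1], the dilation by [k] repeats each term [k] times. *)
Record generalized_limit (R : realType) (w : (nat -> R^o) -> R) : Prop := {
  genlim_linear : forall (c : R) (a b : nat -> R^o),
    bounded_fun a -> bounded_fun b ->
    w (fun n => c * a n + b n) = c * w a + w b;
  genlim_ge0 : forall a : nat -> R^o,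
    bounded_fun a -> (forall n, 0 <= a n) -> 0 <= w a;
  genlim_lim : forall (a : nat -> R^o) (l : R^o), a @ \oo --> l -> w a = l;
  genlim_dilation : forall (k : nat) (a : nat -> R^o),
    (0 < k)%N -> bounded_fun a -> w (fun n => a (n %/ k)%N) = w a
}.

Section Hausdorff.
Context {R : realType} (X : metricType R).
Local Open Scope ereal_scope.

Definition diam (F : set X) : \bar R :=
  ereal_sup [set (mdist z.1 z.2)%:E | z in F `*` F].

(* The covers are indexed by subsets of [nat]: they may be finite or empty. *)
Definition closed_cover (t : R) (I : set nat) (F : nat -> set X) : Prop :=
  (forall n, I n -> [/\ closed (F n), F n !=set0 & diam (F n) <= t%:E]) /\
  [set: X] `<=` \bigcup_(n in I) F n.

Definition hausdorff_pre (p t : R) : \bar R :=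
  ereal_inf [set \esum_(n in c.1) (diam (c.2 n) `^ p) |
             c in [set c : set nat * (nat -> set X) | closed_cover t c.1 c.2]].

Definition hausdorff_measure (p : R) : \bar R :=
  lim (hausdorff_pre p t @[t --> (0 : R)^'+]).

End Hausdorff.

(* Main.v *)
(* The operator [|ds|] multiplies the sections by the length [|b|]: if [A >= 0]
   and [A^2 e = l^2 e] with [l > 0], then [u = A e - l e] satisfies
   [A u = - l u], so [u = 0], and the vectors supported at one point span a
   dense subspace.
   Hence the [n]-th eigenvalue of [|ds|^p] is at least [t^p] as soon as
   [n < N(t)], the number of points of [B_t] counted with multiplicity.
   If [nu' > nu], then for small [t] the balls of radius [nu' t] around the
   points of [Y_t] cover [X], whence [H^p_{2 nu' t}(X) <= N(t) (2 nu' t)^p].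
   So [N(t) >= c / (2 nu' t)^p] for small [t] if [c < H^p(X)]; solving
   [c / (2 nu' t)^p = n + 1] gives [mu_n >= (c / (2 nu')^p) / (n + 1)] for large
   [n], and comparison with the harmonic series yields
   [Tr_w(|ds|^p) >= c / (2 nu')^p]. *)
Require Import Defs.
From mathcomp Require Import all_boot all_order all_algebra.
From mathcomp Require Import all_classical all_reals all_analysis finmap.
From mathcomp Require Import ring.

Import Order.TTheory GRing.Theory Num.Theory.
Import numFieldNormedType.Exports.

Local Open Scope classical_set_scope.
Local Open Scope ring_scope.
Local Open Scope complex_scope.

(** * Decreasing rearrangement of a function with finite superlevel sets *)

Section Rearrangement.
Context {R : realType} {T : choiceType} {S : set T} {f : T -> R}.
Hypothesis f_fin : forall t : R, 0 < t -> finite_set [set s | S s /\ t <= f s].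

Let level t := [set s | S s /\ t <= f s].
Let N t := #|` fset_set (level t)|.

(** The witness is the [n]-th largest value of [f], counted from 0, or 0 if no superlevel set has
    more than [n] points. *)
Lemma rearrangement_term (n : nat) :
  exists x : R, 0 <= x /\ forall t : R, 0 < t -> (t <= x) = (n < N t)%N.
Proof.
have [[t0 [t00 nt0]]|no] := pselect (exists t, 0 < t /\ (n < N t)%N);
  last first.
  exists 0; split=> // t t0; rewrite leNgt t0; apply/esym/negP => nt.
  by apply: no; exists t.
(* Negation makes the increasing sort list the values of [f] in decreasing order. *)
pose vs := sort <=%R [seq - f s | s <- enum_fset (fset_set (level t0))].
have svs : sorted <=%R vs by exact: sort_le_sorted.
have cnt t : t0 <= t -> count (<= - t) vs = N t.
  move=> tt0; rewrite count_sort count_map -size_filter /N.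
  have t_gt0 : 0 < t by exact: lt_le_trans tt0.
  apply/perm_size/uniq_perm; rewrite ?filter_uniq ?fset_uniq// => s.
  rewrite mem_filter /= lerN2 !in_fset_set; [|exact: f_fin..].
  apply/andP/idP; rewrite !in_setE.
    by move=> [tf [Ss _]].
  by move=> [Ss tf]; do 2?split => //; exact: le_trans tf.
have nvs : (n < size vs)%N.
  by apply: leq_trans (count_size (<= - t0) vs); rewrite cnt.
have vst0 : t0 <= - nth 0 vs n.
  by rewrite lerNr; apply: nth_count_le => //; rewrite cnt.
exists (- nth 0 vs n); split=> [|t tt]; first exact: le_trans (ltW t00) vst0.
(* For [t < t0] both sides are true, since lowering the threshold enlarges the level set. *)
have [tt0|tt0] := leP t0 t; last first.
  rewrite (le_trans (ltW tt0) vst0); apply/esym/(leq_trans nt0).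
  apply: fsubset_leq_card; rewrite -fset_set_sub; [|exact: f_fin..].
  by move=> s [Ss ?]; split => //; apply: le_trans (ltW tt0) _.
apply/idP/idP => [|ntt]; last first.
  by rewrite lerNr; apply: nth_count_le => //; rewrite cnt.
apply: contraLR; rewrite -leqNgt -ltNge ltrNl => ntt.
by apply: nth_count_gt => //; rewrite cnt// ntt.
Qed.

(** The indices with value [l] run from the number of points where [f > l] up to the number where
    [f >= l]. These point sets are nested, so the difference counts the points where [f = l]. *)
Lemma decreasing_rearrangement : exists mu : nat -> R,
  [/\ forall n, 0 <= mu n, forall n, mu n.+1 <= mu n &
      forall l : R, 0 < l ->
        ([set n | mu n = l] #= [set s | S s /\ f s = l])%card].
Proof.
have [mu /all_and2[mu0 muP]] := choice rearrangement_term.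
exists mu; split=> // [n|l l0].
  have [->//|] := eqVneq (mu n.+1) 0.
  move=> mu1; have {}mu1 : 0 < mu n.+1 by rewrite lt0r mu1 mu0.
  by rewrite muP// ltnW// -muP.
have sub : [set s | S s /\ l < f s] `<=` level l by move=> s [Ss /ltW].
have fin' := sub_finite_set sub (f_fin _ l0).
pose N' := #|` fset_set [set s | S s /\ l < f s]|.
have muP' n : (l < mu n) = (n < N')%N.
  apply/idP/idP => [lmu|].
    have := lexx (mu n); rewrite muP ?(lt_trans l0)// => /leq_trans; apply.
    apply: fsubset_leq_card; rewrite -fset_set_sub//.
      by move=> s [Ss ?]; split => //; exact: lt_le_trans lmu _.
    by apply: f_fin; exact: lt_trans l0 lmu.
  (* Only finitely many points have [f > l], so their values are bounded below by some [t > l], to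
     which [muP] applies. *)
  have [t lt tP] : exists2 t, l < t &
      forall s, s \in enum_fset (fset_set [set s | S s /\ l < f s]) -> t <= f s.
    have : forall s, s \in enum_fset (fset_set [set s | S s /\ l < f s]) ->
        l < f s.
      by move=> s; rewrite in_fset_set// in_setE => -[].
    elim: (enum_fset _) => [_|a r IH ar].
      by exists (l + 1); rewrite ?ltrDl.
    have [|t lt tP] := IH.
      by move=> s sr; apply: ar; rewrite inE sr orbT.
    exists (Num.min t (f a)); first by rewrite lt_min lt ar// mem_head.
    move=> s; rewrite inE ge_min => /orP[/eqP->|/tP->//]; by rewrite lexx orbT.
  move=> nN'; apply: (lt_le_trans lt); rewrite muP ?(lt_trans l0 lt)//.
  apply: leq_trans nN' _; apply: fsubset_leq_card; rewrite -fset_set_sub//.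
    move=> s sS; split; first by case: sS.
    by apply: tP; rewrite in_fset_set// in_setE.
  by apply: f_fin; exact: lt_trans l0 lt.
have -> : [set n | mu n = l] = `I_(N l) `\` `I_N'.
  apply/seteqP; split=> n /=.
    move=> mul; split; first by rewrite -muP// mul.
    by apply/negP; rewrite -muP' mul ltxx.
  rewrite -muP// => -[lmu /negP]; rewrite -muP' -leNgt => mul.
  by apply/eqP; rewrite eq_le lmu mul.
have -> : [set s | S s /\ f s = l] = level l `\` [set s | S s /\ l < f s].
  apply/seteqP; split=> s /=.
    by move=> [Ss fs]; split; [split; rewrite ?fs|rewrite fs ltxx => -[]].
  move=> [[Ss lf] /not_andP[//|/negP]]; rewrite -leNgt => fl.
  by split=> //; apply/eqP; rewrite eq_le lf fl.
apply: card_eq_trans card_IID _; rewrite card_eq_sym.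
rewrite -[_ `\` _]fset_setK; last exact/finite_setD/f_fin.
apply/card_eq_fsetP; rewrite fset_setD//; last exact: f_fin.
rewrite cardfsDS// -fset_set_sub//; exact: f_fin.
Qed.

End Rearrangement.

(** * Lower bounds for generalized limits *)

Section GeneralizedLimit.
Context {R : realType} {w : (nat -> R^o) -> R}.
Hypothesis hw : generalized_limit w.

(* [a] is split into [min a c], which tends to [c], and a nonnegative part. *)
Lemma generalized_limit_ge (a : nat -> R^o) (c : R) :
  bounded_fun a -> (forall e : R, 0 < e -> \forall n \near \oo, c - e <= a n) ->
  c <= w a.
Proof.
move=> ba ac; pose d : nat -> R^o := fun n => Num.min (a n) c.
have dc : d @ \oo --> (c : R^o).
  apply/cvgrPdist_le => e e0; near=> n.
  have dn : d n <= c by rewrite ge_min lexx orbT.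
  rewrite ger0_norm ?subr_ge0// lerBlDl -lerBlDr le_min gerBl (ltW e0) andbT.
  by near: n; exact: ac.
have bd : bounded_fun d by apply: cvg_seq_bounded; apply/cvg_ex; exists c.
have bad : bounded_fun (fun n => -1 * d n + a n : R^o).
  rewrite (_ : (fun n => _) = (fun n => - d n + a n)).
    exact: (bounded_funD (bounded_funN bd) ba).
  by apply/funext => n; rewrite mulN1r.
have wa : w (fun n => -1 * d n + a n) = -1 * c + w a.
  by rewrite genlim_linear// (genlim_lim hw dc).
rewrite -subr_ge0 addrC -mulN1r -wa; apply: (genlim_ge0 hw) => // n.
by rewrite mulN1r addrC subr_ge0 ge_min lexx.
Unshelve. all: by end_near. Qed.

End GeneralizedLimit.

(** * Logarithmic means and the harmonic series *)

Section LogMean.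
Context {R : realType} {mu : nat -> R} {c : R} {n0 : nat}.
Hypotheses (mu_ge0 : forall n, 0 <= mu n) (c_ge0 : 0 <= c).
Hypothesis mu_ge : forall n, (n0 <= n)%N -> c / n.+1%:R <= mu n.

(** The logarithm telescopes with increments [ln (1 + 1 / (N + 1)) <= 1 / (N + 1)]; up to [n0] the
    left side is nonpositive. *)
Lemma harmonic_minorant_sum_ge (N : nat) :
  c * (ln N.+1%:R - ln n0.+1%:R) <= \sum_(k < N) mu k.
Proof.
have [Nn0|] := leqP N n0.
  apply: (@le_trans _ _ 0); last exact: sumr_ge0.
  by rewrite mulr_ge0_le0// subr_le0 ler_ln ?posrE ?ltr0n// ler_nat.
elim: N => // N IH; rewrite ltnS leq_eqVlt => n0N.
have {}IH : c * (ln N.+1%:R - ln n0.+1%:R) <= \sum_(k < N) mu k.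
  case/orP: n0N => [/eqP<-|/IH//].
  by rewrite subrr mulr0 sumr_ge0.
have {n0N} n0N : (n0 <= N)%N by rewrite leq_eqVlt.
rewrite big_ord_recr /=; apply: le_trans (lerD IH (mu_ge _ n0N)).
rewrite -mulrDr ler_wpM2l// addrAC lerD2r -lerBlDl.
have N0 : (0 : R) < N.+1%:R by rewrite ltr0n.
rewrite -ln_div ?posrE ?ltr0n//.
have -> : N.+2%:R / N.+1%:R = 1 + N.+1%:R^-1 :> R.
  by rewrite -[N.+2]add1n natrD mulrDl mul1r divff ?gt_eqF// addrC.
apply: le_ln1Dx; apply: lt_trans (_ : 0 < _); last by rewrite invr_gt0.
by rewrite ltrN10.
Qed.

Lemma near_log_mean_ge (e : R) : 0 < e ->
  \forall n \near \oo, c - e <= (\sum_(k < n.+1) mu k) / ln n.+1%:R.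
Proof.
move=> e0; near=> n.
have K0 : 0 <= ln (n0.+1%:R : R) by rewrite ln_ge0// ler1n.
have n1 : (1 : R) < n.+1%:R.
  by rewrite ltr1n ltnS; near: n; exact: nbhs_infty_gt.
have ln0 : 0 < ln (n.+1%:R : R) by rewrite ln_gt0.
(* The constant lost at [n0] is absorbed by [e]: this asks that [n + 1] exceed a fixed
   exponential. *)
have lnK : c * ln n0.+1%:R <= e * ln n.+1%:R.
  rewrite -ler_pdivrMl// mulrC -[leLHS]expRK ler_ln ?posrE ?expR_gt0 ?ltr0n//.
  apply: (@le_trans _ _ n%:R); last by rewrite ler_nat.
  by near: n; exact: nbhs_infty_ger.
rewrite ler_pdivlMr//; apply: le_trans (harmonic_minorant_sum_ge _).
have : ln (n.+1%:R : R) <= ln n.+2%:R.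
  by rewrite ler_ln ?posrE ?ltr0n// ler_nat.
rewrite mulrBl mulrBr => lnn; apply: lerB => //.
by rewrite ler_wpM2l.
Unshelve. all: by end_near. Qed.

End LogMean.

(** * Sums of complex families *)

Section ComplexSums.
Context {R : realType} {I : choiceType} (D : set I).

(** Of the four extended sums in [csum] only that of the positive real parts survives. This brings
    scalar products back to extended sums. *)
Lemma csum_ge0E (f : I -> R[i]) (g : I -> R) : (forall b, D b -> 0 <= g b) ->
  (forall b, D b -> f b = (g b)%:C) ->
  csum D f = (fine (\esum_(b in D) (g b)%:E))%:C.
Proof.
move=> g0 fg; apply/eqP; rewrite eq_complex /csum /rsum /=; apply/andP; split.
  rewrite [X in fine X - _](@eq_esum _ _ _ _ (fun b => (g b)%:E)); last first.
    by move=> b Db; rewrite funeposE /= fg//= maxEge lee_fin g0.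
  rewrite [X in _ - fine X]esum1 ?subr0// => b Db.
  rewrite funenegE /= fg//= maxEge lee_fin oppr_ge0.
  by case: ltgtP (g0 _ Db) => //= <-; rewrite ?oppr0.
rewrite !esum1 ?subrr// => b Db.
  by rewrite funenegE /= fg//= oppr0 maxxx.
by rewrite funeposE /= fg//= maxxx.
Qed.

Lemma csumN (f : I -> R[i]) : csum D (fun b => - f b) = - csum D f.
Proof.
have rsumN (g : I -> R) : rsum D (fun b => - g b) = - rsum D g.
  rewrite /rsum opprB; congr (fine _ - fine _); apply: eq_esum => b _.
    by rewrite funeposE funenegE.
  by rewrite funeposE funenegE /= -?EFinN opprK.
have compE (h : R[i] -> R) : (forall z, h (- z) = - h z) ->
    rsum D (fun b => h (- f b)) = - rsum D (fun b => h (f b)).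
  by move=> hN; rewrite -rsumN; congr rsum; apply/funext => b.
by rewrite /csum !compE//; case.
Qed.

Lemma csum_single (f : I -> R[i]) (b0 : I) : D b0 ->
  (forall b, D b -> b <> b0 -> f b = 0) -> csum D f = f b0.
Proof.
move=> Db0 f0.
have esum_single (h : I -> \bar R) : (forall b, 0 <= h b)%E ->
    (forall b, D b -> b <> b0 -> h b = 0%E) -> \esum_(b in D) h b = h b0.
  move=> h0 hb; rewrite (esumID [set b0])//.
  rewrite (setIidr (_ : [set b0] `<=` D)); last by move=> _ ->.
  rewrite esum_set1// esum1 ?adde0// => b [Db]; exact: hb.
have rsum_single (g : I -> R) : (forall b, D b -> b <> b0 -> g b = 0) ->
    rsum D g = g b0.
  move=> gb; rewrite /rsum !esum_single//.
  - rewrite funeposE funenegE /= -[X in X - _]/(fine (maxe (g b0)%:E 0%:E)).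
    rewrite -!EFin_max/=; case: (leP 0 (g b0)) => g0.
      by rewrite (max_idPr _) ?oppr_le0// subr0.
    by rewrite (max_idPl _) ?oppr_ge0 ?(ltW g0)// opprK add0r.
  - by move=> b Db bb0; rewrite funenegE /= gb// oppr0 maxxx.
  - by move=> b Db bb0; rewrite funeposE /= gb// maxxx.
apply/eqP; rewrite eq_complex /csum /= !rsum_single ?eqxx// => b Db bb0;
  by rewrite f0.
Qed.

End ComplexSums.

Lemma mulcJ_cabs2 (R : rcfType) (z : R[i]) : z * z^* = (cabs2 z)%:C.
Proof. by case: z => a b; rewrite /cabs2 /=; simpc; congr Complex; ring. Qed.

Lemma cabs2_real (R : rcfType) (a : R) : cabs2 a%:C = a ^+ 2.
Proof. by rewrite /cabs2 /= expr0n addr0. Qed.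

Lemma cabs2_eq0 (R : rcfType) (z : R[i]) : (cabs2 z == 0) = (z == 0).
Proof.
by case: z => a b; rewrite /cabs2 /= paddr_eq0 ?sqr_ge0// !sqrf_eq0 eq_complex.
Qed.

(** * Norms, basis vectors and diagonal operators *)

Section DiagonalOperators.
Context {R : realType} {X : metricType R} (M : spectral_geometry X).
Implicit Types (u v : hilb M) (b : X * X) (T : hilb M -> hilb M).
Implicit Types (g : X * X -> R).

(** The squared Hilbert norm, kept as an extended real. *)
Definition energy v : \bar R := \esum_(b in supp M) (fibre_norm2 M v b)%:E.

Lemma energy_fin v : (energy v < +oo)%E.
Proof. by case: v => xi xi2; move/asboolP: (xi2) => []. Qed.

Lemma energy_ge0 v : (0 <= energy v)%E.
Proof. by apply: esum_ge0 => b _; rewrite lee_fin fibre_norm2_ge0. Qed.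

Lemma energy_fineK v : (fine (energy v))%:E = energy v.
Proof. by rewrite fineK// ge0_fin_numE ?energy_fin ?energy_ge0. Qed.

Lemma hilb_ext u v :
  (forall b i, supp M b -> (i < mult M b)%N -> u b i = v b i) -> u = v.
Proof.
move=> uv; apply/val_inj/funext => b; apply/funext => i /=.
have [[Bb im]|nb] := pselect (supp M b /\ (i < mult M b)%N); first exact: uv.
have out w : w \in square_summable M -> w b i = 0 by move=> /asboolP[->].
by rewrite !out//; exact: valP.
Qed.

Lemma cabs2_le_energy v b i : supp M b -> (i < mult M b)%N ->
  ((cabs2 (v b i))%:E <= energy v)%E.
Proof.
move=> Bb im; apply: esum_ge; exists [set b].
  by split; [exact: finite_set1|move=> _ ->].
rewrite fsbig_set1 lee_fin /fibre_norm2 (bigD1 (Ordinal im))//= lerDl.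
by apply: sumr_ge0 => j _; exact: cabs2_ge0.
Qed.

Lemma inner_self v : inner M v v = (fine (energy v))%:C.
Proof.
apply: csum_ge0E => [b _|b _]; first exact: fibre_norm2_ge0.
by rewrite rmorph_sum; apply: eq_bigr => i _; exact: mulcJ_cabs2.
Qed.

Lemma innerNl u v : inner M (- u) v = - inner M u v.
Proof.
rewrite /inner -csumN; congr csum; apply/funext => b.
by rewrite -sumrN; apply: eq_bigr => i _; rewrite -mulNr.
Qed.

(* Zero unless [i0] is an index of the fibre over [b0]: this makes [basis_vec]
   total. *)
Definition basis_section b0 (i0 : nat) : X * X -> nat -> R[i] := fun b i =>
  if `[< supp M b0 /\ (i0 < mult M b0)%N >] && (b == b0) && (i == i0)
  then 1 else 0.

Lemma basis_subproof b0 i0 : basis_section b0 i0 \in square_summable M.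
Proof.
apply/asboolP; split => [b i bi|].
  rewrite /basis_section; case: asboolP => //= h.
  by case: eqVneq => //= bb0; case: eqVneq => // ii0; subst; case: bi.
apply: le_lt_trans (_ : (\esum_(b in supp M `&` [set b0])
    (fibre_norm2 M (basis_section b0 i0) b)%:E < +oo)%E).
  rewrite esum_mkcondr; apply: le_esum => b _; case: ifPn => //.
  rewrite notin_setE /= => bb0; rewrite lee_fin /fibre_norm2 big1// => i _.
  rewrite /basis_section; case: eqVneq => // _.
  by rewrite andbF /= /cabs2 /= expr0n addr0.
rewrite esum_fset; last by move=> b _; rewrite lee_fin fibre_norm2_ge0.
  by rewrite fsumEFin ?ltry//; apply: finite_setI; right.
by apply: finite_setI; right.
Qed.

Definition basis_vec b0 i0 : hilb M := Hilb (basis_subproof b0 i0).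

Lemma basis_sectionE b0 i0 b i : supp M b0 -> (i0 < mult M b0)%N ->
  basis_section b0 i0 b i = if (b == b0) && (i == i0) then 1 else 0.
Proof. by move=> Bb im; rewrite /basis_section asboolT. Qed.

(** Lets identities between scalar products be read as identities between coordinates. *)
Lemma inner_basis_vec v b i : supp M b -> (i < mult M b)%N ->
  inner M v (basis_vec b i) = v b i.
Proof.
move=> Bb im; rewrite /inner (csum_single _ _ b)//.
  rewrite (bigD1 (Ordinal im))//= basis_sectionE// !eqxx /= rmorph1 mulr1.
  rewrite big1 ?addr0// => j; rewrite -val_eqE /= => ji.
  by rewrite /= basis_sectionE// eqxx (negbTE ji) /= rmorph0 mulr0.
move=> b' _ /eqP bb'; rewrite big1// => j _.
by rewrite /= basis_sectionE// (negbTE bb') rmorph0 mulr0.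
Qed.

(** Imposed at all [b] and [i]: outside the fibres both sides vanish. *)
Definition diagonal g T := forall v b i, T v b i = (g b)%:C * v b i.

Lemma diagonal_exists g (k : R) :
  (forall b, supp M b -> cabs2 (g b)%:C <= k) -> exists T, diagonal g T.
Proof.
move=> gk.
have gs v : (fun b i => (g b)%:C * v b i) \in square_summable M.
  by apply: (square_summable_mul gk); exact: valP.
by exists (fun v => Hilb (gs v)).
Qed.

Lemma diagonal_bounded_operator g (k : R) T :
  (forall b, supp M b -> cabs2 (g b)%:C <= k) -> diagonal g T ->
  bounded_operator (inner M) T.
Proof.
move=> gk gT; split.
  move=> a u v; apply: hilb_ext => b i _ _.
  by rewrite [RHS]/(a * T u b i + T v b i) !gT /= mulrDr mulrCA.
exists `|k| => v; rewrite !inner_self -rmorphM lecR.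
rewrite -lee_fin EFinM !energy_fineK.
have k0 : 0 <= `|k| by [].
apply: le_trans (esum_scale_le (supp M) k0 (fibre_norm2_ge0 M v)).
apply: le_esum => b Bb; rewrite lee_fin /fibre_norm2 mulr_sumr.
apply: ler_sum => i _; rewrite gT cabs2M ler_wpM2r ?cabs2_ge0//.
exact: le_trans (gk _ Bb) (ler_norm _).
Qed.

Lemma diagonal_inner_ge0 g T : (forall b, supp M b -> 0 <= g b) ->
  diagonal g T -> forall v, 0 <= inner M (T v) v.
Proof.
move=> g0 gT v.
rewrite /inner (csum_ge0E _ _ (fun b => g b * fibre_norm2 M v b)).
- rewrite lecR fine_ge0// esum_ge0// => b Bb.
  by rewrite lee_fin mulr_ge0 ?g0 ?fibre_norm2_ge0.
- by move=> b Bb; rewrite mulr_ge0 ?g0 ?fibre_norm2_ge0.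
move=> b _; rewrite rmorphM rmorph_sum /= mulr_sumr; apply: eq_bigr => i _.
by rewrite gT -mulrA -mulcJ_cabs2.
Qed.

End DiagonalOperators.

(** * Bounded operators determined by their values on basis vectors *)

Section AbsoluteValue.
Context {R : realType} {X : metricType R} (M : spectral_geometry X).
Implicit Types (u v : hilb M) (b : X * X) (T A : hilb M -> hilb M).
Implicit Types (g : X * X -> R).

Lemma sectionBZ (a : R[i]) u v b i : (u - a *: v) b i = u b i - a * v b i.
Proof. by []. Qed.

Lemma sectionZ (a : R[i]) u b i : (a *: u) b i = a * u b i.
Proof. by []. Qed.

Lemma basis_vecE b0 i0 b i : supp M b0 -> (i0 < mult M b0)%N ->
  basis_vec M b0 i0 b i = if (b, i) == (b0, i0) then 1 else 0.
Proof. by move=> Bb im; rewrite /= basis_sectionE// xpair_eqE. Qed.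

Lemma linearBZ T (a : R[i]) u v : linear T -> T (u - a *: v) = T u - a *: T v.
Proof. by move=> lT; rewrite addrC -scaleNr lT scaleNr addrC. Qed.

(* [T v - g v] does not change when finitely many coordinates of [v] are set to
   zero; what remains of [v] has arbitrarily small norm. *)
Lemma clear_coordinates g T (r : seq ((X * X) * nat)) v :
  linear T ->
  (forall b i, supp M b -> (i < mult M b)%N ->
    T (basis_vec M b i) = (g b)%:C *: basis_vec M b i) ->
  exists u, forall b i,
    u b i = (if (b, i) \in r then 0 else v b i) /\
    T v b i - (g b)%:C * v b i = T u b i - (g b)%:C * u b i.
Proof.
move=> lT Te; elim: r => [|[b0 i0] r [u uP]]; first by exists v.
have [[Bb0 im0]|nb0] := pselect (supp M b0 /\ (i0 < mult M b0)%N); last first.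
  exists u => b i; have [ub Tu] := uP b i; split => //.
  rewrite inE; case: eqP => //= -[-> ->].
  by move/asboolP: (valP u) => [->].
pose u' : hilb M := u - u b0 i0 *: basis_vec M b0 i0; exists u' => b i.
have [ub Tu] := uP b i; split.
  rewrite sectionBZ basis_vecE// inE; case: eqP => [[-> ->]|_].
    by rewrite mulr1 subrr.
  by rewrite mulr0 subr0.
rewrite linearBZ// Te// Tu.
rewrite !sectionBZ sectionZ basis_vecE//; case: eqP => [[-> _]|_]; ring.
Qed.

(** The energy is the supremum of its finite partial sums, so one of them misses at most [e]. *)
Lemma energy_tail v (e : R) : 0 < e ->
  exists2 F : set (X * X), finite_set F &
    (\esum_(b in supp M `&` ~` F) (fibre_norm2 M v b)%:E <= e%:E)%E.
Proof.
move=> e0; have vfin : energy M v \is a fin_num.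
  by rewrite ge0_fin_numE ?energy_fin ?energy_ge0.
have [_ [F [finF FB] <-] Fe] := ub_ereal_sup_adherent e0 vfin.
exists F => //; move: Fe.
rewrite -/(esum _ _) -/(energy M v) [X in (X - _)%E](esumID F); last first.
  by move=> b _; rewrite lee_fin fibre_norm2_ge0.
rewrite (setIidr FB) esum_fset//; last first.
  by move=> b _; rewrite lee_fin fibre_norm2_ge0.
rewrite fsumEFin//.
set s := esum _ _; case: s => [s|//|_].
  by rewrite -EFinD lte_fin lee_fin ltrBlDr ltrD2l => /ltW.
by rewrite leNye.
Qed.

(** Clearing finitely many coordinates of [v] keeps the defect [T v b i - g b * v b i] and makes the
    norm small; boundedness of [T] then makes the defect smaller than any [e]. *)
Lemma diagonal_of_basis g T : bounded_operator (inner M) T ->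
  (forall b i, supp M b -> (i < mult M b)%N ->
    T (basis_vec M b i) = (g b)%:C *: basis_vec M b i) ->
  diagonal M g T.
Proof.
move=> [lT [k Tk]] Te v b i.
have [[Bb im]|nb] := pselect (supp M b /\ (i < mult M b)%N); last first.
  have out u : u b i = 0 by move/asboolP: (valP u) => [->].
  by rewrite !out mulr0.
apply/eqP; rewrite -subr_eq0 -cabs2_eq0; apply/eqP/le_anti.
rewrite cabs2_ge0 andbT; apply/ler_addgt0Pl => e e0; rewrite addr0.
have K0 : 0 < `|k| + 1 by rewrite ltr_wpDl.
have [F finF Fe] := energy_tail v _ (divr_gt0 e0 K0).
pose r := [seq (c, j) | c <- enum_fset (fset_set F), j <- iota 0 (mult M c)].
(* Besides all coordinates over [F], the coordinate [(b, i)] is cleared, so that the defect of [u]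
   is just [T u b i]. *)
have [u uP] := clear_coordinates g T ((b, i) :: r) v lT Te.
have [ubi ->] := uP b i; rewrite ubi mem_head mulr0 subr0.
rewrite -lee_fin; apply: le_trans (cabs2_le_energy M _ _ _ Bb im) _.
have ue : (energy M u <= (e / (`|k| + 1))%:E)%E.
  apply: le_trans Fe; rewrite esum_mkcondr; apply: le_esum => c Bc.
  rewrite in_setC; case: (boolP (c \in F)) => cF /=; rewrite lee_fin.
    rewrite /fibre_norm2 big1// => j _; have [-> _] := uP c j.
    have cjr : (c, nat_of_ord j) \in r.
      apply/allpairsPdep; exists c, (nat_of_ord j).
      by split; rewrite ?mem_iota//= in_fset_set.
    by rewrite inE cjr orbT /cabs2 /= expr0n addr0.
  apply: ler_sum => j _; have [-> _] := uP c j.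
  by case: ifP => // _; rewrite {1}/cabs2 /= expr0n addr0 cabs2_ge0.
have := Tk u; rewrite !inner_self -rmorphM lecR => Tuk.
rewrite -energy_fineK lee_fin; apply: le_trans Tuk _.
rewrite -energy_fineK lee_fin in ue.
rewrite -(divfK (lt0r_neq0 K0) e) mulrC.
have u0 : 0 <= fine (energy M u) by rewrite fine_ge0// energy_ge0.
apply: le_trans (ler_wpM2r (ltW K0) ue); rewrite ler_wpM2l//.
by rewrite (le_trans (ler_norm _))// lerDl.
Qed.

End AbsoluteValue.

(** * Identification of the absolute value of [ds] and of its powers *)

Section AbsDs.
Context {R : realType} {X : metricType R} (M : spectral_geometry X).
Implicit Types (u v : hilb M) (b : X * X) (T A : hilb M -> hilb M).
Implicit Types (p : R).

Lemma csum_flip (f : X * X -> R[i]) :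
  csum (supp M) (f \o flip) = csum (supp M) f.
Proof.
have flip_bij : set_bij (supp M) (supp M) flip.
  split; [by move=> b; exact: supp_flip| |].
    by move=> b b' _ _; exact: (can_inj flipK).
  by move=> b Bb; exists (flip b); [exact: supp_flip|exact: flipK].
have rsum_flip (g : X * X -> R) : rsum (supp M) (g \o flip) = rsum (supp M) g.
  rewrite /rsum; congr (fine _ - fine _).
    rewrite [RHS](reindex_esum _ _ _ _ flip_bij); apply: eq_esum => b _.
    by rewrite !funeposE.
  rewrite [RHS](reindex_esum _ _ _ _ flip_bij); apply: eq_esum => b _.
  by rewrite !funenegE.
rewrite /csum; congr Complex.
  exact: (rsum_flip (fun b => complex.Re (f b))).
exact: (rsum_flip (fun b => complex.Im (f b))).
Qed.

(** The substitution [flip] preserves lengths and multiplicities and carries one sum to the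
    other. *)
Lemma inner_ds T : diagonal M len T ->
  forall v w, inner M (T (T v)) w = inner M (ds M v) (ds M w).
Proof.
move=> TD v w; rewrite /inner -csum_flip.
have flip_len b : len (flip b) = len b by rewrite /len metric_sym.
have csum_ext (f f' : X * X -> R[i]) : (forall b, supp M b -> f b = f' b) ->
    csum (supp M) f = csum (supp M) f'.
  move=> ff'; rewrite /csum /rsum.
  congr (Complex (fine _ - fine _) (fine _ - fine _));
  by apply: eq_esum => b Bb; rewrite ?funeposE ?funenegE /= ff'.
apply: csum_ext => b Bb /=.
rewrite mult_flip//; apply: eq_bigr => i _.
have conjZ (a : R) (z : R[i]) : Num.conj (a%:C * z) = a%:C * Num.conj z.
  by rewrite rmorphM; congr (_ * _); exact: conjc_real.
by rewrite !TD flip_len conjZ; ring.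
Qed.

Lemma abs_operator_basis A b i : is_abs_operator (inner M) (ds M) A ->
  supp M b -> (i < mult M b)%N ->
  A (basis_vec M b i) = (len b)%:C *: basis_vec M b i.
Proof.
move=> [[[lA _] A0] AA] Bb im; set e := basis_vec M b i; set l := len b.
have l0 : 0 < l by rewrite /l /len mdist_gt0; apply/eqP; exact: supp_offdiag Bb.
have [k kP] := len_bounded M; have [D Dlen] := diagonal_exists M _ _ kP.
(* The condition on [A] concerns scalar products only; testing against basis vectors yields the
   coordinates of [A (A e)]. *)
have AAe : A (A e) = (l ^+ 2)%:C *: e.
  apply: hilb_ext => c j Bc jm.
  rewrite -[LHS]inner_basis_vec// AA -(inner_ds _ Dlen) inner_basis_vec//.
  rewrite !Dlen sectionZ basis_vecE//; case: eqP => [[-> _]|_].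
    by rewrite !mulr1 -rmorphM.
  by rewrite !mulr0.
(* Since [(A + l) (A - l) e = 0], the vector [u] satisfies [A u = - l u]. *)
pose u := A e - l%:C *: e.
have Au : A u = - (l%:C *: u).
  rewrite /u linearBZ// AAe scalerBr scalerA -rmorphM opprB.
  by rewrite expr2 addrC.
(* Positivity now says that [l] times the squared norm of [u] is at most 0. *)
have := A0 u; rewrite Au innerNl oppr_ge0.
have fl0 c : 0 <= l * fibre_norm2 M u c.
  by rewrite mulr_ge0 ?fibre_norm2_ge0 ?ltW.
rewrite /inner (csum_ge0E _ _ (fun c => l * fibre_norm2 M u c))//; last first.
  move=> c _; rewrite rmorphM rmorph_sum mulr_sumr; apply: eq_bigr => j _.
  by rewrite sectionZ -mulrA /= -mulcJ_cabs2.
rewrite lecR -lee_fin fineK; last first.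
  rewrite ge0_fin_numE; last by apply: esum_ge0 => c _; rewrite lee_fin.
  apply: le_lt_trans (esum_scale_le _ (ltW l0) (fibre_norm2_ge0 M u)) _.
  by rewrite lte_mul_pinfty ?lee_fin ?ltW//; exact: energy_fin.
move=> lu0; have u0 : (energy M u <= 0)%E.
  have -> : energy M u =
      \esum_(c in supp M) (l^-1 * (l * fibre_norm2 M u c))%:E.
    by apply: eq_esum => c _; rewrite mulKf// gt_eqF.
  have l'0 : 0 <= l^-1 by rewrite invr_ge0 ltW.
  apply: le_trans (esum_scale_le _ l'0 fl0) _.
  by rewrite mule_ge0_le0// lee_fin.
apply/eqP; rewrite -subr_eq0 -/u; apply/eqP; apply: hilb_ext => c j Bc jm.
apply/eqP; rewrite -cabs2_eq0 eq_le cabs2_ge0 andbT -lee_fin.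
exact: le_trans (cabs2_le_energy M u c j Bc jm) u0.
Qed.

(** Multiplication by the length is an absolute value, so [xget] returns a genuine one; its action
    on basis vectors then identifies it. *)
Lemma abs_ds_diagonal : diagonal M len (abs_operator (inner M) (ds M)).
Proof.
set A := abs_operator _ _; have [k kP] := len_bounded M.
have Aabs : is_abs_operator (inner M) (ds M) A.
  have [D Dlen] := diagonal_exists M _ _ kP.
  apply: (@xgetI _ _ (is_abs_operator (inner M) (ds M)) D).
  split; last exact: inner_ds.
  split; first exact: diagonal_bounded_operator kP Dlen.
  by apply: diagonal_inner_ge0 Dlen => b _; exact: mdist_ge0.
apply: diagonal_of_basis; first by case: Aabs => -[].
by move=> b i; exact: abs_operator_basis.
Qed.

Lemma power_operator_diagonal p A : 0 < p -> diagonal M len A ->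
  diagonal M (fun b => len b `^ p) (power_operator (inner M) A p).
Proof.
move=> p0 Alen; set P := power_operator _ _ _.
have [k kP] := len_bounded M.
have len0 b : 0 <= len b by exact: mdist_ge0.
have pP b : supp M b -> cabs2 (len b `^ p)%:C <= `|k| `^ p.
  move=> /kP; rewrite !cabs2_real => lk.
  rewrite -powR_mulrn ?powR_ge0// -powRrM mulrC powRrM powR_mulrn//.
  apply: ge0_ler_powR; first exact: ltW.
  - by rewrite nnegrE sqr_ge0.
  - by rewrite nnegrE.
  exact: le_trans lk (ler_norm k).
have Ppow : is_power_operator (inner M) A p P.
  have [D Dlen] := diagonal_exists M _ _ pP.
  apply: (@xgetI _ _ (is_power_operator (inner M) A p) D).
  split; first exact: diagonal_bounded_operator pP Dlen.
  move=> l v l0 Av; apply: hilb_ext => b i _ _.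
  (* A coordinate of an eigenvector for [l] is zero unless it lies over a point of length [l]. *)
  rewrite Dlen sectionZ; have := congr1 (fun u : hilb M => u b i) Av.
  rewrite Alen sectionZ => /eqP; rewrite -subr_eq0 -mulrBl mulf_eq0.
  case/orP => [|/eqP ->]; last by rewrite !mulr0.
  by rewrite -rmorphB /= => /eqP[/eqP]; rewrite subr_eq0 => /eqP ->.
apply: diagonal_of_basis; first by case: Ppow.
move=> b i Bb im; apply: (proj2 Ppow) => //.
apply: hilb_ext => c j _ _; rewrite Alen sectionZ basis_vecE//.
by case: eqP => [[->]|_]; rewrite ?mulr0.
Qed.

End AbsDs.

(** * Uniqueness of dimension and counting of values *)

Lemma has_dim_le {R : realType} {V : lmodType R[i]} (E : set V) (d d' : nat) :
  has_dim E d -> has_dim E d' -> (d <= d')%N.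
Proof.
move=> [e [Ee eP]] [f [Ef fP]]; rewrite leqNgt; apply/negP => d'd.
have ef i : exists c : 'rV[R[i]]_d', e i = \sum_(j < d') c 0 j *: f j.
  by have [c [cP _]] := fP _ (Ee i); exists c.
have [C CP] := choice ef; pose A : 'M[R[i]]_(d, d') := \matrix_i C i.
(* With more vectors [e] than [f], the coordinate matrix has a nonzero left kernel vector, hence a
   linear relation among the [e i]. *)
have kA0 : kermx A != 0.
  rewrite -mxrank_eq0 mxrank_ker subn_eq0 -ltnNge.
  exact: leq_ltn_trans (rank_leq_col A) d'd.
have [u /sub_kermxP uA u0] := rowV0Pn kA0.
have ue : \sum_(i < d) u 0 i *: e i = 0.
  transitivity (\sum_(j < d') (u *m A) 0 j *: f j); last first.
    by rewrite uA big1// => j _; rewrite mxE scale0r.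
  under eq_bigr => i _ do rewrite CP scaler_sumr.
  rewrite exchange_big /=; apply: eq_bigr => j _.
  rewrite mxE scaler_suml; apply: eq_bigr => i _.
  by rewrite mxE scalerA.
have d0 : (0 < d)%N by exact: leq_ltn_trans d'd.
(* Adding the relation [u] to the coordinates of any one vector contradicts their uniqueness. *)
have [c [cP c_uniq]] := eP _ (Ee (Ordinal d0)).
have cu : c = c + u.
  apply: c_uniq; rewrite [LHS]cP -[LHS]addr0 -[X in _ + X = _]ue -big_split /=.
  by apply: eq_bigr => i _; rewrite mxE scalerDl.
by move/negP: u0; apply; rewrite -[u](addKr c) -cu addNr.
Qed.

(** If [mu n < t], the points with [f >= t] inject into the indices below [n], so there are at most
    [n] of them. *)
Lemma nonincreasing_ge_of_count {R : realType} {T : Type} (S : set T)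
    (f : T -> R) (mu : nat -> R) (t : R) (n : nat) :
  (forall n, mu n.+1 <= mu n) ->
  (forall l : R, 0 < l ->
    ([set n | mu n = l] #= [set s | S s /\ f s = l])%card) ->
  0 < t -> (`I_n.+1 #<= [set s | S s /\ t <= f s])%card -> t <= mu n.
Proof.
move=> mu_dec mu_count t0 nS; rewrite leNgt; apply/negP => mut.
have emb l : exists h : T -> nat, 0 < l ->
    (forall s, S s -> f s = l -> mu (h s) = l) /\
    {in [set s | S s /\ f s = l] &, injective h}.
  have [l0|_] := boolP (0 < l); last by exists (fun=> 0%N).
  have := mu_count l l0; rewrite card_eq_le => /andP[_ /pcard_leP[h]].
  exists h => _; split; last exact: 'inj_h.
  by move=> s Ss fs; have /(_ s (conj Ss fs)) := 'funS_h.
have [h hP] := choice emb.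
(* The injections chosen for the separate values glue to one injection, since [mu (j s)] recovers
   [f s]. *)
pose j s := h (f s) s.
have muj s : S s -> t <= f s -> mu (j s) = f s.
  by move=> Ss tf; apply: (hP _ (lt_le_trans t0 tf)).1.
have : ([set s | S s /\ t <= f s] #<= `I_n)%card.
  apply: card_le_trans (_ : (_ #<= j @` [set s | S s /\ t <= f s])%card) _.
    rewrite (card_le_eqr (inj_card_eq _))// => s s'.
    rewrite !in_setE => -[Ss tf] [Ss' tf'] jj.
    have ff' : f s = f s' by rewrite -muj// jj muj.
    have [_ hinj] := hP _ (lt_le_trans t0 tf).
    by apply: hinj; rewrite ?in_setE// /j in jj *; rewrite jj ff'.
  apply: subset_card_le => _ [s [Ss tf] <-] /=.
  rewrite ltnNge; apply/negP => nj.
  have : mu (j s) <= mu n by apply: (proj1 (nonincreasing_seqP mu)) nj.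
  by rewrite muj// leNgt (lt_le_trans mut tf).
by move=> /(card_le_trans nS); rewrite card_le_II ltnn.
Qed.

(** * Eigenvalue sequence of a diagonal operator *)

Section Spectrum.
Context {R : realType} {X : metricType R} {M : spectral_geometry X}.
Context {g : X * X -> R} {T : hilb M -> hilb M}.
Hypothesis Tg : diagonal M g T.

(** Counting these pairs counts the points of the support with multiplicity. *)
Definition basis_index : set ((X * X) * nat) :=
  [set s | supp M s.1 /\ (s.2 < mult M s.1)%N].

(** An eigenvector for [l] has no coordinates where [g] differs from [l], so the basis vectors over
    [g = l] form a basis of the eigenspace. *)
Lemma diagonal_eigenspace_dim (l : R) (d : nat) :
  ([set s | basis_index s /\ g s.1 = l] #= `I_d)%card ->
  has_dim (eigenspace_of T l) d.
Proof.
set K := [set s | _] => Kd.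
have finK : finite_set K by apply/finite_setP; exists d.
have /eqP Ksize := card_fset_set Kd.
pose t := Tuple Ksize; pose h := tnth t.
have hinj : injective h by apply/tuple_uniqP; exact: fset_uniq.
have hK i : K (h i).
  by have := mem_tnth i t; rewrite -/(h i) in_fset_set// in_setE.
have Kh s : K s -> exists i, s = h i.
  by move=> Ks; apply/tnthP; rewrite in_fset_set// in_setE.
pose e i := basis_vec M (h i).1 (h i).2.
have eE i b j : e i b j = if (b, j) == h i then 1 else 0.
  by have [[Bb jm] _] := hK i; rewrite /e basis_vecE//; case: (h i).
have sumE (c : 'rV[R[i]]_d) b j :
    (\sum_(i < d) c 0 i *: e i) b j = \sum_(i < d) c 0 i * e i b j.
  exact: (big_morph (fun u : hilb M => u b j) (fun _ _ => erefl) erefl).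
have sum_h (c : 'rV[R[i]]_d) i :
    (\sum_(i < d) c 0 i *: e i) (h i).1 (h i).2 = c 0 i.
  rewrite sumE (bigD1 i)// eE -surjective_pairing eqxx mulr1.
  rewrite big1 => [|k /andP[_ ki]]; first exact: addr0.
  by rewrite eE -surjective_pairing (inj_eq hinj) eq_sym (negbTE ki) mulr0.
exists e; split=> [i|v Tv].
  apply: hilb_ext => b j _ _; rewrite Tg sectionZ eE.
  by case: eqP => [bj|_]; rewrite ?mulr0// -(hK i).2 -bj.
exists (\row_i v (h i).1 (h i).2); split; last first.
  by move=> c vc; apply/rowP => i; rewrite mxE [in LHS]vc sum_h.
apply: hilb_ext => b j Bb jm.
have [[i bj]|no] := pselect (exists i, (b, j) = h i).
  by have := sum_h (\row_i v (h i).1 (h i).2) i; rewrite [RHS]mxE -bj => /esym.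
rewrite sumE big1 => [|i _]; last first.
  by rewrite eE; case: eqP => [bj|_]; rewrite ?mulr0//; case: no; exists i.
apply/eqP/negPn/negP => vbj; apply: no; apply: Kh; split => //=.
have : T v b j = l%:C * v b j by rewrite -sectionZ; congr (section_of _ b j).
rewrite Tg => /eqP; rewrite -subr_eq0 -mulrBl mulf_eq0 (negbTE vbj) orbF.
by rewrite -rmorphB /= => /eqP[/eqP]; rewrite subr_eq0 => /eqP ->.
Qed.

Hypothesis g_fin : forall t : R, 0 < t ->
  finite_set [set s | basis_index s /\ t <= g s.1].

(** The decreasing rearrangement of [g] shows that [xget] returns a true eigenvalue sequence;
    uniqueness of dimension then fixes how often each value occurs. *)
Lemma diagonal_eigenvalue_seq : is_eigenvalue_seq T (eigenvalue_seq T) /\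
  forall l : R, 0 < l ->
    ([set n | eigenvalue_seq T n = l] #=
      [set s | basis_index s /\ g s.1 = l])%card.
Proof.
have level_fin l : 0 < l ->
    exists d, ([set s | basis_index s /\ g s.1 = l] #= `I_d)%card.
  move=> l0; apply/finite_setP; apply: sub_finite_set (g_fin _ l0).
  by move=> s [Ss gs]; split => //; rewrite gs.
have spec : is_eigenvalue_seq T (eigenvalue_seq T).
  have [mu [mu0 mu_dec mu_count]] := decreasing_rearrangement g_fin.
  apply: (@xgetI _ _ (is_eigenvalue_seq T) mu); split => // l l0.
  have [d Kd] := level_fin l l0; exists d; split.
    exact: diagonal_eigenspace_dim.
  exact: card_eq_trans (mu_count l l0) Kd.
split=> // l l0; have [_ _ /(_ l l0)[d [dimd mud]]] := spec.
have [d' Kd'] := level_fin l l0; have dimd' := diagonal_eigenspace_dim l d' Kd'.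
have dd' : d = d'.
  apply/eqP; rewrite eqn_leq (has_dim_le _ _ _ dimd dimd').
  exact: has_dim_le dimd' dimd.
by apply: card_eq_trans mud _; rewrite card_eq_sym dd'.
Qed.

End Spectrum.

(** * Hausdorff measure and coverings by balls *)

Section HausdorffMeasure.
Context {R : realType} {X : metricType R}.
Implicit Types (p r t : R).

Lemma closed_mdist_ball (x : X) r : closed [set z | mdist x z <= r].
Proof.
move=> z zcl /=; apply/ler_addgt0Pl => e e0.
have [y [/= xy]] := zcl _ (nbhsx_ballx z e e0).
rewrite ballEmdist /= => zy; apply: le_trans (metric_triangle x y z) _.
by rewrite addrC lerD// metric_sym ltW.
Qed.

Lemma diam_ge0 (F : set X) : F !=set0 -> (0 <= diam F)%E.
Proof.
move=> [x Fx]; apply: ereal_sup_ubound; exists (x, x) => //=.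
by rewrite mdistxx.
Qed.

Lemma diam_mdist_ball (x : X) r :
  (diam [set z | (mdist x z <= r)%R] <= (2 * r)%:E)%E.
Proof.
apply: ge_ereal_sup => _ [[y z] [/= xy xz] <-]; rewrite lee_fin.
apply: le_trans (metric_triangle y x z) _; rewrite (metric_sym y).
by rewrite mulr_natl mulr2n lerD.
Qed.

Lemma hausdorff_pre_le_balls (T : Type) (A : set T) (N : nat) (y : T -> X) p r :
  0 <= p -> 0 <= r -> (A #<= `I_N)%card ->
  (forall x, exists2 s, A s & mdist (y s) x <= r) ->
  (hausdorff_pre X p (2 * r) <= (N%:R * (2 * r) `^ p)%:E)%E.
Proof.
move=> p0 r0 /pcard_leP[h] cover.
(* A family indexed by all of [nat]; by injectivity of [h], each index in the image of [A] carries
   exactly one ball. *)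
pose F n := [set x | exists2 s, A s & h s = n /\ mdist (y s) x <= r].
have FE s : A s -> F (h s) = [set x | mdist (y s) x <= r].
  move=> As; apply/seteqP; split=> x /=; last by exists s.
  by move=> [s' As' [/'inj_h <-]]; rewrite ?in_setE.
have IN : h @` A `<=` `I_N by move=> _ [s As <-]; exact: ('funS_h).
have cov : closed_cover (2 * r) (h @` A) F.
  split=> [_ [s As <-]|x _].
    rewrite FE//; split; [exact: closed_mdist_ball| |exact: diam_mdist_ball].
    by exists (y s); rewrite /= mdistxx.
  by have [s As yx] := cover x; exists (h s); exists s.
apply: ge_ereal_inf; exists (\esum_(n in h @` A) (diam (F n) `^ p))%E.
  by exists (h @` A, F).
apply: (@le_trans _ _ (\esum_(n in `I_N) ((2 * r) `^ p)%:E)%E); last first.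
    rewrite esum_fset//; last by move=> n _; rewrite lee_fin powR_ge0.
    rewrite fsbig_finite//= sumEFin big_const_seq count_predT.
    have Ncard : #|` fset_set `I_N| = N by exact: card_fset_set (card_eqxx _).
    by rewrite Ncard iter_addr_0 lee_fin [leRHS]mulr_natl.
  apply: (@le_trans _ _ (\esum_(n in h @` A) ((2 * r) `^ p)%:E)%E).
    apply: le_esum => n hn; rewrite -poweR_EFin.
    have [_ F0 Fr] := cov.1 n hn.
    apply: gt0_ler_poweR => //; rewrite in_itv/= andbC leey ?diam_ge0//.
    by rewrite lee_fin mulr_ge0.
  rewrite -(setIidl IN) esum_mkcondl; apply: le_esum => n _.
  by case: ifP => // _; rewrite lee_fin powR_ge0.
Qed.

Lemma hausdorff_pre_antitone p t t' : t <= t' ->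
  (hausdorff_pre X p t' <= hausdorff_pre X p t)%E.
Proof.
move=> tt'; apply: le_ereal_inf => _ [c [cF cX] <-]; exists c => //.
split=> // n cn; have [Fcl F0 Ft] := cF n cn; split => //.
by apply: le_trans Ft _; rewrite lee_fin.
Qed.

(** By monotonicity the limit at 0 is a supremum, so [c] is exceeded at some [t0] and then at every
    smaller [t]. *)
Lemma lt_hausdorff_measure p (c : \bar R) : (c < hausdorff_measure X p)%E ->
  exists2 t0 : R, 0 < t0 &
    forall t, t <= t0 -> (c < hausdorff_pre X p t)%E.
Proof.
have Hcvg : hausdorff_pre X p t @[t --> (0 : R)^'+] -->
    ereal_sup (hausdorff_pre X p @` [set` `]0, +oo[ ]).
  apply: (nonincreasing_at_right_cvge (BInfty _ false)) => //.
  by move=> t t' _ _; exact: hausdorff_pre_antitone.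
have -> : hausdorff_measure X p =
    ereal_sup (hausdorff_pre X p @` [set` `]0, +oo[ ]).
  exact: cvg_lim.
move=> /ereal_sup_gt[_ [t0 /= t0I <-] ct0].
have t00 : 0 < t0 by move: t0I; rewrite in_itv /= andbT.
exists t0 => // t tt0.
exact: lt_le_trans ct0 (hausdorff_pre_antitone _ _ _ tt0).
Qed.

(** A limsup below [nu'] gives, for all small [t], an admissible radius [d < nu' * t]. As [d > 0],
    this also forces [nu' > 0]. *)
Lemma rel_bounding_radius_lt (M : spectral_geometry X) (nu nu' : R) :
  rel_bounding_radius M = nu%:E -> nu < nu' ->
  0 < nu' /\ exists2 t0 : R, 0 < t0 & forall t x, 0 < t < t0 ->
    exists b, [/\ supp M b, t <= len b & mdist b.1 x <= nu' * t].
Proof.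
move=> Mnu nunu'.
have : (rel_bounding_radius M < nu'%:E)%E by rewrite Mnu lte_fin.
move=> /ereal_inf_lt[_ [V V0 <-] Vnu'].
have [t0 /= t00 Vt] := (nbhs_ballP _ _).1 V0.
have dV t : 0 < t < t0 -> exists d : R, [/\ 0 < d, d < nu' * t &
    [set: X] `<=` \bigcup_(y in proj_supp M t) [set x | mdist y x <= d]].
  move=> /andP[tgt0 tt0].
  have {}Vt : V t by apply: Vt => //=; rewrite /ball/= sub0r normrN gtr0_norm.
  have : (bounding_radius M t * (t^-1)%:E < nu'%:E)%E.
    by apply: le_lt_trans Vnu'; apply: ereal_sup_ubound; exists t.
  rewrite lte_pdivrMr// -EFinM => /ereal_inf_lt[_ [d [d0 dX] <-]].
  by rewrite lte_fin => dt; exists d.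
split.
  have [|d [d0 dt _]] := dV (t0 / 2).
    by rewrite divr_gt0//= ltr_pdivrMr// ltr_pMr// ltr1n.
  by move: (lt_trans d0 dt); rewrite pmulr_lgt0// divr_gt0.
exists t0 => // t x tt0; have [d [_ dt dX]] := dV t tt0.
have [_ [b [Bb tb] <-] /= bx] := dX x I.
by exists b; split => //; exact: le_trans bx (ltW dt).
Qed.

End HausdorffMeasure.

(** * Eigenvalue estimate and lower bound for the Dixmier trace *)

Lemma basis_index_finite {R : realType} {X : metricType R}
    (M : spectral_geometry X) (p t : R) : 0 < p -> 0 < t ->
  finite_set [set s | basis_index (M := M) s /\ t <= len s.1 `^ p].
Proof.
(* The threshold [t] on [p]-th powers of lengths becomes [tau] on lengths, which finitely many
   points of the support reach. *)
move=> p0 t0; pose tau := t `^ p^-1.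
have tau0 : 0 < tau by exact: powR_gt0.
apply: (@sub_finite_set _ _
  (\bigcup_(b in [set b | supp M b /\ tau <= len b]) pair b @` `I_(mult M b))).
  move=> [b i] [[/= Bb im] tb]; exists b => /=; last by exists i.
  split=> //; have len0 : 0 <= len b by exact: mdist_ge0.
  rewrite -[leRHS](powRr1 len0) -(mulfV (lt0r_neq0 p0)) powRrM.
  apply: ge0_ler_powR => //; first by rewrite invr_ge0 ltW.
    by rewrite nnegrE ltW.
  by rewrite nnegrE powR_ge0.
apply: bigcup_finite => [|b _]; first exact: supp_finite.
exact/finite_image/finite_II.
Qed.

Section Comparison.
Context {R : realType} {X : metricType R} {M : spectral_geometry X}.
Context {nu p : R}.
Hypotheses (Mnu : rel_bounding_radius M = nu%:E) (p0 : 0 < p).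

Let P := power_operator (inner M) (abs_operator (inner M) (ds M)) p.

Lemma eigenvalue_seq_power_abs_ds :
  is_eigenvalue_seq P (eigenvalue_seq P) /\
  forall l : R, 0 < l -> ([set n | eigenvalue_seq P n = l] #=
    [set s | basis_index (M := M) s /\ len s.1 `^ p = l])%card.
Proof.
apply: (diagonal_eigenvalue_seq (g := fun b => len b `^ p)).
  by apply: power_operator_diagonal => //; exact: abs_ds_diagonal.
by move=> t; exact: basis_index_finite.
Qed.

(** Put [s = k / (n + 1)] and [t = s^(1/p)]. If only [N <= n] basis indices had [len^p >= s], the
    balls of radius [nu' t] would give a premeasure at most [N (2 nu')^p s = c N / (n + 1) <= c], a
    contradiction. *)
Lemma eigenvalue_seq_ge (nu' c : R) : nu < nu' -> 0 < c ->
  (c%:E < hausdorff_measure X p)%E ->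
  exists n0, forall n, (n0 <= n)%N ->
    c / (2 * nu') `^ p / n.+1%:R <= eigenvalue_seq P n.
Proof.
move=> nunu' c0 /lt_hausdorff_measure[t0 t00 ct0].
have [nu'0 [t1 t10 cover]] := rel_bounding_radius_lt M _ _ Mnu nunu'.
have [[_ mu_dec _] mu_count] := eigenvalue_seq_power_abs_ds.
have N0 : 0 < 2 * nu' by rewrite mulr_gt0.
set k := c / (2 * nu') `^ p.
have k0 : 0 < k by rewrite divr_gt0// powR_gt0.
(* For [t <= tau] the covering is available, as [t < t1], and the balls have diameter at most
   [2 nu' t <= t0]. *)
pose tau := Num.min (t1 / 2) (t0 / (2 * nu')).
have tau0 : 0 < tau by rewrite lt_min !divr_gt0.
have taup : 0 < tau `^ p by exact: powR_gt0.
(* Beyond this index [s <= tau^p], that is, [t <= tau]. *)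
exists (Num.bound (k / tau `^ p)) => n n0.
set s := k / n.+1%:R.
have s0 : 0 < s by rewrite divr_gt0// ltr0n.
have stau : s <= tau `^ p.
  rewrite ler_pdivrMr ?ltr0n// mulrC -ler_pdivrMr//.
  apply/ltW/(lt_le_trans (archi_boundP _)); first by rewrite ltW// divr_gt0.
  by rewrite ler_nat leqW.
pose t := s `^ p^-1.
have tgt0 : 0 < t by exact: powR_gt0.
have tp : t `^ p = s by rewrite -powRrM mulVf ?lt0r_neq0// powRr1// ltW.
have ttau : t <= tau.
  rewrite -[leRHS](powRr1 (ltW tau0)) -(mulfV (lt0r_neq0 p0)) powRrM.
  apply: ge0_ler_powR => //; first by rewrite invr_ge0 ltW.
    by rewrite nnegrE ltW.
  by rewrite nnegrE ltW.
apply: (nonincreasing_ge_of_count _ _ _ _ _ mu_dec mu_count s0).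
have finA := basis_index_finite M p s p0 s0.
have /finite_setP[N AN] := finA; rewrite (card_le_eqr AN) card_le_II.
rewrite ltnNge; apply/negP => Nn.
pose A := [set a | basis_index (M := M) a /\ s <= len a.1 `^ p].
have Xcover x : exists2 a, A a &
    mdist a.1.1 x <= nu' * t.
  have [|b [Bb tb bx]] := cover t x.
    by rewrite tgt0 (le_lt_trans ttau)// gt_min ltr_pdivrMr// ltr_pMr// ltr1n.
  (* Index 0 exists in the fibre because multiplicities are positive. *)
  exists (b, 0%N) => //; split; first by split => //; exact: mult_gt0.
  rewrite /= -tp; apply: ge0_ler_powR => //; first exact: ltW.
    by rewrite nnegrE ltW.
  by rewrite nnegrE (le_trans (ltW tgt0)).
have AN' : (A #<= `I_N)%card.
  by rewrite (card_le_eql AN).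
have nut0 : 0 <= nu' * t by rewrite mulr_ge0// ltW.
have :=
  hausdorff_pre_le_balls _ _ _ (fun a => a.1.1) _ _ (ltW p0) nut0 AN' Xcover.
have /ct0 : 2 * (nu' * t) <= t0.
  rewrite mulrA mulrC -ler_pdivlMr//; apply: le_trans ttau _.
  by rewrite ge_min lexx orbT.
move=> /lt_le_trans/[apply]; rewrite lte_fin mulrA powRM ?ltW// tp.
rewrite ltNge; apply/negP; rewrite negbK.
have -> : N%:R * ((2 * nu') `^ p * s) = N%:R / n.+1%:R * c.
  have n1 : (n.+1%:R : R) != 0 by rewrite pnatr_eq0.
  have nu'p : (2 * nu') `^ p != 0 by rewrite lt0r_neq0 ?powR_gt0.
  rewrite /s /k; move: (n.+1%:R) n1 ((2 * nu') `^ p) nu'p => x x0 y y0.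
  by field; rewrite x0 y0.
apply: ler_piMl; first exact: ltW.
rewrite ler_pdivrMr ?ltr0n// mul1r ler_nat.
exact: leqW.
Qed.

(** If the logarithmic means are unbounded the trace is [+oo]; otherwise the eigenvalue estimate
    bounds them below, up to any [e], for large indices. *)
Lemma le_dixmier_trace (w : (nat -> R^o) -> R) (nu' c : R) :
  generalized_limit w -> nu < nu' -> 0 < c ->
  (c%:E < hausdorff_measure X p)%E ->
  ((c / (2 * nu') `^ p)%:E <= dixmier_trace w P)%E.
Proof.
move=> hw nunu' c0 cH; have [n0 mu_ge] := eigenvalue_seq_ge _ _ nunu' c0 cH.
rewrite /dixmier_trace; case: asboolP => [bP|_]; last exact: leey.
have k0 : 0 <= c / (2 * nu') `^ p by rewrite divr_ge0 ?powR_ge0 ?ltW.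
have [[mu_ge0 _ _] _] := eigenvalue_seq_power_abs_ds.
rewrite lee_fin; apply: generalized_limit_ge => // e e0.
exact: (near_log_mean_ge mu_ge0 k0 mu_ge e e0).
Qed.

Lemma dixmier_trace_ge0 (w : (nat -> R^o) -> R) :
  generalized_limit w -> (0 <= dixmier_trace w P)%E.
Proof.
move=> hw; rewrite /dixmier_trace; case: asboolP => [bP|_]; last exact: leey.
have [[mu_ge0 _ _] _] := eigenvalue_seq_power_abs_ds.
rewrite lee_fin; apply: (genlim_ge0 hw) => // n.
by rewrite divr_ge0 ?ln_ge0 ?ler1n// sumr_ge0.
Qed.

End Comparison.

(** The case [nu = 0], [H > 0] is stated apart because the product of 0 and [+oo] is 0 in the
    extended reals. *)
Theorem theorem4p4 (R : realType) (X : metricType R) (cX : compact [set: X])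
    (M : spectral_geometry X)
    (w : (nat -> R^o) -> R) (hw : generalized_limit w)
    (nu : R) (hnu : rel_bounding_radius M = nu%:E)
    (p : R) (hp : 0 < p) :
  let abs_ds := abs_operator (inner M) (ds M) in
  let Tr := dixmier_trace w (power_operator (inner M) abs_ds p) in
  let H := hausdorff_measure X p in
  (nu = 0 /\ (0 < H)%E -> Tr = +oo%E) /\
  (~ (nu = 0 /\ (0 < H)%E) -> (H <= ((2 * nu) `^ p)%:E * Tr)%E).
Proof.
move=> abs_ds Tr H.
have Tr_ge (nu' c : R) : nu < nu' -> 0 < c -> (c%:E < H)%E ->
    ((c / (2 * nu') `^ p)%:E <= Tr)%E.
  exact: le_dixmier_trace.
have Tr0 : (0 <= Tr)%E by exact: dixmier_trace_ge0.
have H_pos (h : (0 < H)%E) : exists2 c : R, 0 < c & (c%:E < H)%E.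
  case: (H) h => [h|_|//]; last by exists 1; rewrite ?ltry.
  rewrite lte_fin => h0; exists (h / 2); first by rewrite divr_gt0.
  by rewrite lte_fin ltr_pdivrMr// ltr_pMr// ltr1n.
split=> [[nu0 /H_pos[c c0 cH]]|nuH].
  case: Tr Tr_ge Tr0 => [tau|//|//] Tr_ge tau0.
  have tau1 : 0 < tau + 1 by rewrite ltr_wpDl.
  (* Chosen so that [(2 nu')^p = c / (tau + 1)]: a finite trace [tau] would then be at least
     [tau + 1]. *)
  pose nu' := (c / (tau + 1)) `^ p^-1 / 2.
  have c'0 : 0 < c / (tau + 1) by rewrite divr_gt0.
  have := Tr_ge nu' c; rewrite nu0 divr_gt0 ?powR_gt0// => /(_ isT c0 cH).
  rewrite /nu' [2 * _]mulrC divfK// -powRrM mulVf ?lt0r_neq0//.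
  rewrite (powRr1 (ltW c'0)).
  by rewrite invf_div mulrCA divff ?lt0r_neq0// mulr1 lee_fin gerDl ler10.
(* If [nu < 0], then 0 could serve as [nu'], which has to be positive. *)
have nu_ge0 : 0 <= nu.
  rewrite leNgt; apply/negP => nu0.
  by have [] := rel_bounding_radius_lt M _ _ hnu nu0; rewrite ltxx.
have [H0|H0] := leP H 0%E.
  by apply: le_trans H0 _; rewrite mule_ge0// lee_fin powR_ge0.
have nu0 : 0 < nu.
  by rewrite lt0r nu_ge0 andbT; apply/eqP => nu0; apply: nuH.
have nup : 0 < (2 * nu) `^ p by apply: powR_gt0; rewrite mulr_gt0.
case: Tr Tr_ge Tr0 => [tau| |//] Tr_ge tau0; last first.
  by rewrite gt0_muley ?lte_fin// leey.
rewrite -EFinM; apply/lee_addgt0Pr => e e0.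
rewrite leNgt; apply/negP; rewrite -EFinD; set a := (2 * nu) `^ p * tau => aH.
have a0 : 0 <= a by rewrite mulr_ge0// ltW.
have a1 : 0 < a + 1 by rewrite ltr_wpDl.
(* The factor [q > 1] satisfies [a q < a + e], while the bound with [c = a + e] and
   [nu' = nu q^(1/p)] would give [a + e <= a q]. *)
pose q := 1 + e / (a + 1).
have q1 : 1 < q by rewrite ltrDl divr_gt0.
have q0 : 0 < q by exact: lt_trans q1.
have nu_lt : nu < nu * q `^ p^-1.
  rewrite ltr_pMr//; have {1}<- : (1 : R) `^ p^-1 = 1 by rewrite powR1.
  by apply: gt0_ltr_powR; rewrite ?nnegrE ?invr_gt0// ltW.
have ae0 : 0 < a + e by rewrite ltr_wpDl.
have := Tr_ge _ _ nu_lt ae0 aH.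
rewrite lee_fin mulrA powRM ?powR_ge0//; last by rewrite ltW// mulr_gt0.
rewrite -powRrM mulVf ?lt0r_neq0// (powRr1 (ltW q0)) ler_pdivrMr ?mulr_gt0//.
rewrite mulrCA mulrA -/a leNgt; apply/negP; rewrite negbK.
rewrite /q mulrDr mulr1 ltrD2l mulrCA -[ltRHS]mulr1 ltr_pM2l//.
by rewrite ltr_pdivrMr// mul1r ltrDl.
Qed.
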